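(* Let $X\neq\emptyset$ be a set, $v:At\to\mathcal{P}(X)$ a valuation, $\mathcal{D}=(X,v)$, and let $\mathfrak{r}:At\to\mathcal{P}(X)$ be a function with $\mathfrak{r}(p)\subseteq v(p)$ for every $p\in At$. Then the class $\mathbb{M}^{\mathcal{D},\mathfrak{r}}$ has a smallest model with respect to $\leq$; that is, there exists $\mathcal{M}=(X,\mathcal{T},v)\in\mathbb{M}^{\mathcal{D},\mathfrak{r}}$ such that $\mathcal{M}\leq\mathcal{M}'$ for every $\mathcal{M}'\in\mathbb{M}^{\mathcal{D},\mathfrak{r}}$.
   Context: Let $At$ be a countable set of atoms. A model is $\mathcal{M}=(X,\mathcal{T},v)$ where $X\neq\emptyset$ is a set, $\mathcal{T}$ is a topology on $X$, and $v:At\to\mathcal{P}(X)$. A propositional formula is one built from atoms using $\neg$ and $\wedge$ only. For propositional $\varphi$, $\mathcal{M},s\models\varphi$ is defined classically with $\mathcal{M},s\models p$ iff $s\in v(p)$, and $||\varphi||^{\mathcal{M}}=\{s\in X:\mathcal{M},s\models\varphi\}$. Moreover $\mathcal{M},s\models\mathcal{R}(\varphi)$ iff $s\in\mathrm{int}(||\varphi||^{\mathcal{M}})$, where $\mathrm{int}(A)=\bigcup\{O\in\mathcal{T}:O\subseteq A\}$. Given $\mathcal{D}=(X,v)$ and $\mathfrak{r}:At\to\mathcal{P}(X)$ with $\mathfrak{r}(p)\subseteq v(p)$ for all $p$, $\mathbb{M}^{\mathcal{D},\mathfrak{r}}$ is the class of all models $(X,\mathcal{T},v)$ (same $X$ and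 $v$) such that $\mathfrak{r}(p)\in\mathcal{T}$ for every $p\in At$. For models $\mathcal{M}_1=(X,\mathcal{T}_1,v)$ and $\mathcal{M}_2=(X,\mathcal{T}_2,v)$, write $\mathcal{M}_1\leq\mathcal{M}_2$ iff for every propositional formula $\varphi$ and every $s\in X$, $\mathcal{M}_1,s\models\mathcal{R}(\varphi)$ implies $\mathcal{M}_2,s\models\mathcal{R}(\varphi)$. *)

(* Defs.v *)
From mathcomp Require Import all_boot.
From mathcomp Require Import boolp classical_sets functions cardinality filter.
From mathcomp Require Import topology_structure.

Set Implicit Arguments.
Unset Strict Implicit.
Unset Printing Implicit Defensive.

Local Open Scope classical_set_scope.

(* Several topologies on one fixed set are compared, so a topology is a family
   of subsets and not a canonical [topologicalType] structure on the carrier;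
   [topology_open] and [topology_int_open] relate the two. *)
Definition is_topology (X : Type) (T : set_system X) : Prop :=
  [/\ T set0,
      T setT,
      setI_closed T &
      forall F : set_system X, F `<=` T -> T (\bigcup_(O in F) O)].

Definition topology_int (X : Type) (T : set_system X) (A : set X) : set X :=
  \bigcup_(O in [set O | T O /\ O `<=` A]) O.

Lemma topology_open (X : topologicalType) : is_topology (@open X).
Proof.
split; [exact: open0 | exact: openT | exact: openI |].
by move=> F sFo; apply: bigcup_open => O /sFo.
Qed.

Lemma topology_int_open (X : topologicalType) (A : set X) :
  topology_int (@open X) A = interior A.
Proof. by rewrite interiorEbigcup. Qed.

Inductive prop_formula (At : Type) : Type :=
| PAtom of At
| PNeg of prop_formula At
| PAnd of prop_formula At & prop_formula At.

Record model (At X : Type) := Model {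
  model_opens : set_system X;
  model_val : At -> set X;
  model_nonempty : [set: X] !=set0;
  model_topology : is_topology model_opens
}.

Section Semantics.
Variables At X : Type.
Implicit Types (M : model At X) (phi : prop_formula At) (s : X).

Fixpoint sat M s phi : Prop :=
  match phi with
  | PAtom p => model_val M p s
  | PNeg psi => ~ sat M s psi
  | PAnd psi chi => sat M s psi /\ sat M s chi
  end.

Definition truth_set M phi : set X := [set s | sat M s phi].

Definition sat_R M s phi : Prop :=
  topology_int (model_opens M) (truth_set M phi) s.

Definition model_class (v r : At -> set X) : set (model At X) :=
  [set M | model_val M = v /\ forall p, model_opens M (r p)].

(* Meant for models with the same valuation. *)
Definition model_le M1 M2 : Prop :=
  forall phi s, sat_R M1 s phi -> sat_R M2 s phi.

End Semantics.

(* Main.v *)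
Require Import Defs.
From mathcomp Require Import all_boot.
From mathcomp Require Import boolp classical_sets functions cardinality.

Local Open Scope classical_set_scope.

(* The topology generated by the sets [r p] gives the smallest model: a coarser
   topology has a smaller interior operator, and the truth set of a
   propositional formula does not depend on the topology. *)

(** Taken as an intersection of topologies rather than as unions of finite intersections of members
    of [G]: the closure conditions pass to intersections, and minimality is immediate. *)
Definition generated_topology (X : Type) (G : set_system X) : set_system X :=
  \bigcap_(T in [set T | is_topology T /\ G `<=` T]) T.

Lemma generated_topologyP (X : Type) (G : set_system X) :
  is_topology (generated_topology X G).
Proof.
split.
- by move=> T [[T0 _ _ _] _].
- by move=> T [[_ TT _ _] _].
- move=> A B GA GB T TG; have [[_ _ TI _] _] := TG.
  exact: TI (GA T TG) (GB T TG).
- move=> F FG T TG; have [[_ _ _ TU] _] := TG.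
  by apply: TU => O FO; exact: FG FO T TG.
Qed.

Lemma sub_generated_topology (X : Type) (G : set_system X) :
  G `<=` generated_topology X G.
Proof. by move=> A GA T [_]; apply. Qed.

Lemma generated_topology_min (X : Type) (G T : set_system X) :
  is_topology T -> G `<=` T -> generated_topology X G `<=` T.
Proof. by move=> Ttop GT A; apply. Qed.

Lemma topology_int_mono (X : Type) (T1 T2 : set_system X) (A : set X) :
  T1 `<=` T2 -> topology_int T1 A `<=` topology_int T2 A.
Proof. by move=> T12 s [O [TO OA] Os]; exists O => //; split=> //; exact: T12. Qed.

(** The clauses of [sat] consult a model only through [model_val]. The induction carries an equality
    because negation would reverse an inclusion. *)
Lemma truth_set_val (At X : Type) (M1 M2 : model At X) phi :
  model_val M1 = model_val M2 -> truth_set M1 phi = truth_set M2 phi.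
Proof.
move=> v12; apply/funext => s; rewrite /truth_set /mkset.
by elim: phi => [p|psi IH|psi IH1 chi IH2] /=; rewrite ?v12 ?IH ?IH1 ?IH2.
Qed.

Lemma model_le_opens (At X : Type) (M1 M2 : model At X) :
  model_val M1 = model_val M2 -> model_opens M1 `<=` model_opens M2 ->
  model_le M1 M2.
Proof.
move=> v12 T12 phi s; rewrite /sat_R (truth_set_val _ _ _ _ phi v12).
exact: topology_int_mono.
Qed.

Theorem theorem6p3 (At : Type) (At_countable : countable [set: At])
    (X : Type) (X_nonempty : [set: X] !=set0)
    (v r : At -> set X) (r_sub_v : forall p : At, r p `<=` v p) :
  exists M : model At X,
    model_class v r M /\
    forall M' : model At X, model_class v r M' -> model_le M M'.
Proof.
exists (Model v X_nonempty (generated_topologyP X (range r))); split.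
  by split=> // p; apply: sub_generated_topology; exists p.
move=> M' [vM' rM']; apply: model_le_opens => //=.
(* The opens of [M'] form a topology containing [range r], so they are one of the families
   intersected. *)
apply: generated_topology_min; first exact: model_topology.
by move=> _ [p _ <-].
Qed.
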